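(* The shortness exponent of the class of $1$-tough planar $3$-trees is at most $\log_{30}{22}$.
   Context: All graphs are finite and simple. For a positive integer $k$, a $k$-tree is either the complete graph $K_k$ or a graph containing a vertex whose neighbourhood induces $K_k$ and whose removal gives a $k$-tree. The toughness of a graph $G$ is the minimum, taken over all separating sets $X$ of vertices of $G$ (sets such that $G-X$ is disconnected), of the ratio of $|X|$ to the number of components of $G-X$; the toughness of a complete graph is infinite. A graph is $t$-tough if its toughness is at least $t$. The shortness exponent of a class of graphs $\Gamma$ is the $\liminf$, taken over all infinite sequences $G_1, G_2, \dots$ of non-isomorphic graphs of $\Gamma$ (for $n$ going to infinity), of $\log_{|V(G_n)|} c(G_n) = \frac{\log c(G_n)}{\log |V(G_n)|}$, where $c(G_n)$ is the length (number of vertices) of a longest cycle in $G_n$; that is, the infimum over all such sequences of $\liminf_{n\to\infty} \log_{|V(G_n)|} c(G_n)$. *)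

(* Defs.v *)
(* MathComp / MathComp-Analysis *)
From HB Require Import structures.
From mathcomp Require Import all_boot all_order all_algebra.
From mathcomp Require Import all_classical all_reals all_analysis.

Set Implicit Arguments.
Unset Strict Implicit.
Unset Printing Implicit Defensive.

Import Order.TTheory GRing.Theory Num.Theory.
Import numFieldNormedType.Exports.

Local Open Scope ring_scope.

Record sgraph := SGraph {
  vertex :> finType;
  adj : rel vertex;
  adj_sym : symmetric adj;
  adj_irrefl : irreflexive adj }.

Definition isomorphic (G H : sgraph) : Prop :=
  exists f : G -> H, bijective f /\ forall x y : G, adj (f x) (f y) = adj x y.

Section Complete.
Variable k : nat.

Definition complete_adj : rel 'I_k := fun i j => i != j.

Lemma complete_adj_sym : symmetric complete_adj.
Proof. by move=> i j; rewrite /complete_adj eq_sym. Qed.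

Lemma complete_adj_irrefl : irreflexive complete_adj.
Proof. by move=> i; rewrite /complete_adj eqxx. Qed.

Definition complete_graph : sgraph :=
  SGraph complete_adj_sym complete_adj_irrefl.
End Complete.

Section Induced.
Variables (G : sgraph) (A : {set G}).

Definition induced_adj : rel {x : G | x \in A} :=
  fun x y => adj (val x) (val y).

Lemma induced_adj_sym : symmetric induced_adj.
Proof. by move=> x y; rewrite /induced_adj adj_sym. Qed.

Lemma induced_adj_irrefl : irreflexive induced_adj.
Proof. by move=> x; rewrite /induced_adj adj_irrefl. Qed.

Definition induced_subgraph : sgraph :=
  SGraph induced_adj_sym induced_adj_irrefl.
End Induced.

Definition neighbourhood (G : sgraph) (v : G) : {set G} :=
  [set x : G | adj v x].

Inductive ktree (k : nat) : sgraph -> Prop :=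
| ktree_complete (G : sgraph) :
    isomorphic G (complete_graph k) -> ktree k G
| ktree_extend (G : sgraph) (v : G) :
    isomorphic (induced_subgraph (neighbourhood v)) (complete_graph k) ->
    ktree k (induced_subgraph (~: [set v])) -> ktree k G.

Definition components (G : sgraph) : nat := n_comp (@adj G) predT.

Definition separating (G : sgraph) (X : {set G}) : bool :=
  (1 < components (induced_subgraph (~: X)))%N.

(* The minimum over no separating set, as in a complete graph, is +oo. *)
Definition toughness (R : realType) (G : sgraph) : \bar R :=
  (\big[mine/+oo]_(X : {set G} | separating X)
     (#|X|%:R / (components (induced_subgraph (~: X)))%:R)%:E)%E.

Definition tough (R : realType) (t : R) (G : sgraph) : Prop :=
  (t%:E <= toughness R G)%E.

(* [arc x y] is constrained only when [x] and [y] are adjacent; by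
   [drawing_rev], [arc x y] and [arc y x] trace the same curve, so that each
   unordered edge is drawn once. *)
Record plane_drawing (R : realType) (G : sgraph)
    (pos : G -> R * R) (arc : G -> G -> R -> R * R) : Prop := PlaneDrawing {
  drawing_pos_inj : injective pos;
  drawing_continuous : forall x y, adj x y ->
    {within `[0, 1], continuous (arc x y)}%classic;
  drawing_arc_inj : forall x y, adj x y ->
    {in `[0, 1] &, injective (arc x y)};
  drawing_start : forall x y, adj x y -> arc x y 0 = pos x;
  drawing_end : forall x y, adj x y -> arc x y 1 = pos y;
  drawing_rev : forall x y, adj x y ->
    {in `[0, 1], forall s, arc y x s = arc x y (1 - s)};
  drawing_avoid : forall x y z, adj x y ->
    {in `]0, 1[, forall s, arc x y s <> pos z};
  drawing_disjoint : forall x y u v, adj x y -> adj u v ->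
    [set x; y] != [set u; v] ->
    {in `]0, 1[ &, forall s t, arc x y s <> arc u v t} }.

Definition planar (R : realType) (G : sgraph) : Prop :=
  exists (pos : G -> R * R) (arc : G -> G -> R -> R * R),
    plane_drawing pos arc.

(* The number of vertices of a longest cycle, and 0 if there is no cycle;
   [ucycleb] also accepts sequences of at most two vertices, whence
   [2 < k]. *)
Definition circumference (G : sgraph) : nat :=
  \max_(k < #|G|.+1 | (2 < k)%N && [exists p : k.-tuple G, ucycleb (@adj G) p])
    k.

Definition logb (R : realType) (b x : R) : R := ln x / ln b.

(* The conventions [ln 0 = 0] and [x / 0 = 0] only affect graphs that have no
   cycle or at most one vertex. *)
Definition shortness_exponent (R : realType) (Gamma : sgraph -> Prop) :
    \bar R :=
  ereal_inf [set l | exists G : nat -> sgraph,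
    [/\ forall n, Gamma (G n),
        forall m n, m <> n -> ~ isomorphic (G m) (G n) &
        l = limn_einf (fun n =>
              (logb #|G n|%:R (circumference (G n))%:R)%:E)]]%classic.

(* Main.v *)
Require Import Defs.
From mathcomp Require Import all_boot all_order all_algebra.
From mathcomp Require Import all_classical all_reals all_analysis.
From mathcomp Require Import zify ring lra.

Set Implicit Arguments.
Unset Strict Implicit.
Unset Printing Implicit Defensive.

Import Order.TTheory GRing.Theory Num.Theory.
Import numFieldNormedType.Exports.

Local Open Scope ring_scope.

(** The shortness exponent is an infimum, so one family of 1-tough planar
    3-trees with short cycles bounds it.  The members of the family are stacked
    triangulations: a vertex is put into a triangle and joined to its three
    corners, and the three new triangles are treated recursively.  Such a graph
    is encoded by the ternary tree of insertions ([network]); it is planar, by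
    the straight-line drawing that puts every new vertex at the barycentre of
    its triangle ([net_planar]), and a 3-tree, by construction
    ([net_ktree]).

    The family is self-similar.  A [pattern] is a network some of whose faces
    are marked as holes, and [tower n.+1] fills every hole of one fixed
    [gadget] with a copy of [tower n].  The gadget has 16 holes, so [tower n]
    has more than 16 ^ n vertices.  Two properties of the gadget matter.

    - Filling preserves toughness.  For a set S of removed corners, consider
      how far the number of components that lie inside the triangle and are cut
      off from the remaining corners can exceed the number of removed inner
      vertices.  This excess is governed by a recursion over the insertions
      ([scatters_insert]).  For the gadget it is 1 if all corners are
      removed and 0 otherwise, exactly as for a triangle that contains a single
      vertex.  Hence all towers have at most this excess.  Together with a
      sharper bound for S empty ([unshattered]), this makes them 1-tough
      ([net_tough]).

    - Paths miss holes.  Let a path run through a triangle from one corner to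
      another, possibly by way of the third.  The number of holes that it visits
      is again bounded by a recursion over the insertions ([bounded_insert]),
      which for the gadget gives 12 out of 16.  Whatever such a path does inside
      a hole is again a path of this kind, so that it visits O(12 ^ n) vertices
      of [tower n].  A cycle, unless it lies in a smaller triangle, is cut by the
      corners and the centre into boundedly many such paths ([cycle_le]).

    So the longest cycle of a graph on N vertices has O(N ^ (log 12 / log 16))
    vertices, and log 12 / log 16 < 9 / 10 < log 22 / log 30, because
    12 ^ 10 < 16 ^ 9 and 30 ^ 9 < 22 ^ 10. *)

(** * Networks *)

Notation o0 := (@Ordinal 3 0 isT).
Notation o1 := (@Ordinal 3 1 isT).
Notation o2 := (@Ordinal 3 2 isT).

Lemma ord3_ind (P : 'I_3 -> Prop) : P o0 -> P o1 -> P o2 -> forall c, P c.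
Proof.
by move=> P0 P1 P2 [[|[|[|n]]] nlt] //; rewrite (bool_irrelevance nlt isT).
Qed.

(** The insertions inside one triangle.  In [Insert f], a vertex is put into the
    triangle, and [f i] describes what happens in the new triangle in which this
    vertex takes the place of corner [i]. *)
Inductive network := Empty | Insert of ('I_3 -> network).

Fixpoint inner (t : network) : finType :=
  match t with
  | Empty => void
  | Insert f => option {i : 'I_3 & inner (f i)}
  end.

(** Adjacency of an inner vertex to the corners.  Corner [c] does not belong to
    the [c]-th of the three new triangles, whence [c != tag u]. *)
Fixpoint touches (t : network) : inner t -> pred 'I_3 :=
  match t with
  | Empty => fun _ _ => false
  | Insert f => fun v c =>
      if v is Some u then (c != tag u) && touches (tagged u) c else true
  end.

(** The centre [None] is corner [tag a] of the new triangle that contains [a]. *)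
Fixpoint inner_adj (t : network) : rel (inner t) :=
  match t with
  | Empty => fun _ _ => false
  | Insert f => fun u v =>
      match u, v with
      | None, None => false
      | None, Some b => touches (tagged b) (tag b)
      | Some a, None => touches (tagged a) (tag a)
      | Some a, Some b =>
          (tag a == tag b) && inner_adj (tagged a) (tagged_as a b)
      end
  end.

Definition net_adj (t : network) : rel ('I_3 + inner t) := fun x y =>
  match x, y with
  | inl c, inl c' => c != c'
  | inl c, inr v => touches v c
  | inr v, inl c => touches v c
  | inr u, inr v => inner_adj u v
  end.

Lemma inner_adj_sym t : symmetric (@inner_adj t).
Proof.
elim: t => [//|f IH] [a|] [b|] //=.
case: a b => i a [j b] /=; rewrite eq_sym; case: (j =P i) => // e.
by case: _ / e a => a; rewrite !tagged_asE; exact: IH.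
Qed.

Lemma inner_adj_irrefl t : irreflexive (@inner_adj t).
Proof.
by elim: t => [//|f IH] [[i a]|] //=; rewrite eqxx tagged_asE IH.
Qed.

Lemma net_adj_sym t : symmetric (@net_adj t).
Proof. by move=> [c|u] [c'|v] //=; [rewrite eq_sym | rewrite inner_adj_sym]. Qed.

Lemma net_adj_irrefl t : irreflexive (@net_adj t).
Proof. by move=> [c|u] /=; [rewrite eqxx | rewrite inner_adj_irrefl]. Qed.

Definition net_graph (t : network) : sgraph :=
  SGraph (@net_adj_sym t) (@net_adj_irrefl t).

Section Face.
Variables (f : 'I_3 -> network) (i : 'I_3).

Definition face_in (v : inner (f i)) : inner (Insert f) :=
  Some (Tagged (fun i => inner (f i)) v).

(** The corners of the [i]-th new triangle are the corners [c != i], and the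
    centre in the role of corner [i]; this makes the graph of [f i] an induced
    subgraph ([face_adj]). *)
Definition face (x : net_graph (f i)) : net_graph (Insert f) :=
  match x with
  | inl c => if c == i then inr None else inl c
  | inr v => inr (face_in v)
  end.

Lemma face_in_inj : injective face_in.
Proof. by move=> u v [] /eqP; rewrite eq_Tagged => /eqP. Qed.

Lemma face_inj : injective face.
Proof.
move=> [c|u] [c'|v] //=; try by case: ifP.
- case: (c =P i) => [ec|_]; case: (c' =P i) => [ec'|_] // E.
  + by rewrite ec ec'.
  + by case: E => ->.
- by case=> /eqP; rewrite eq_Tagged => /eqP <-.
Qed.

Lemma face_adj x y : adj (face x) (face y) = adj x y.
Proof.
case: x y => [c|u] [c'|v] /=.
- case: (c =P i) => [->|/eqP ci]; case: (c' =P i) => [->|/eqP c'i] //=.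
  + by rewrite eqxx.
  + by rewrite eq_sym c'i.
- by case: (c =P i) => [->|/eqP ci] //=; rewrite ci.
- by case: (c' =P i) => [->|/eqP ci] //=; rewrite ci.
- by rewrite eqxx tagged_asE.
Qed.

(** Separation: the corners of a triangle cut its inside off from the rest.
    Every decomposition of a set of removed vertices or of a path according to
    the three new triangles rests on this. *)
Lemma face_closed v y :
  adj (face (inr v)) y -> exists y', y = face y'.
Proof.
case: y => [c|[[j w]|]] /=.
- by case/andP=> ci _; exists (inl c); rewrite /= (negPf ci).
- by case/andP=> /eqP e _; case: _ / e w => w; exists (inr w).
- by move=> _; exists (inl i); rewrite /= eqxx.
Qed.

End Face.

Lemma face_edge f (x y : net_graph (Insert f)) : adj x y ->
  exists i x' y', x = face (i := i) x' /\ y = face (i := i) y'.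
Proof.
have third (c c' : 'I_3) : exists i, (c != i) && (c' != i).
  by elim/ord3_ind: c; elim/ord3_ind: c';
    (by exists o0) || (by exists o1) || (by exists o2).
case: x => [c|[[i u]|]] xy.
- case: y xy => [c'|[[i u]|]] xy.
  + have [i /andP[ci c'i]] := third c c'.
    by exists i, (inl c), (inl c'); rewrite /= (negPf ci) (negPf c'i).
  + rewrite adj_sym in xy; have [x' ex] := face_closed xy.
    by exists i, x', (inr u).
  + have [i /andP[ci _]] := third c c.
    by exists i, (inl c), (inl i); rewrite /= (negPf ci) eqxx.
- by have [y' ey] := face_closed xy; exists i, (inr u), y'.
- case: y xy => [c'|[[i u]|]] // xy.
  + have [i /andP[ci _]] := third c' c'.
    by exists i, (inl i), (inl c'); rewrite /= (negPf ci) eqxx.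
  + by exists i, (inl i), (inr u); rewrite /= eqxx.
Qed.

(** * Straight-line drawings *)

Section Drawing.
Variable R : realType.
Implicit Type m : 'I_3 -> R.

(** In barycentric coordinates, the map of the triangle onto its [i]-th new
    triangle that sends corner [i] to the barycentre.  Its image consists of the
    points whose [i]-th coordinate is minimal. *)
Definition refine (i : 'I_3) m : 'I_3 -> R :=
  fun c => (if c == i then 0 else m c) + m i / 3.

Fixpoint inner_coord (t : network) : inner t -> 'I_3 -> R :=
  match t with
  | Empty => fun _ _ => 0
  | Insert f => fun v =>
      if v is Some u then refine (tag u) (inner_coord (tagged u))
      else fun _ => 3^-1
  end.

Definition coord t (x : net_graph t) : 'I_3 -> R :=
  match x with
  | inl c' => fun c => (c == c')%:R
  | inr v => inner_coord v
  end.

Definition mix (s : R) m m' : 'I_3 -> R := fun c => (1 - s) * m c + s * m' c.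

Lemma coord_face f i (x : net_graph (f i)) : coord (face x) =1 refine i (coord x).
Proof.
case: x => [c'|v] c //=; rewrite /refine.
case: (c' =P i) => [->|/eqP ne] /=.
  by rewrite eqxx; case: (c == i); rewrite !add0r div1r.
rewrite [i == c']eq_sym (negPf ne) mul0r addr0; case: (c =P i) => // ->.
by rewrite eq_sym (negPf ne).
Qed.

Lemma mix_refine i s m m' : mix s (refine i m) (refine i m') =1 refine i (mix s m m').
Proof. by move=> c; rewrite /mix /refine; case: ifP => _; ring. Qed.

Lemma refine_inj i m m' : refine i m =1 refine i m' -> m =1 m'.
Proof.
move=> e c; have := e i; rewrite /refine eqxx => ei.
have {}ei : m i = m' i by lra.
by have := e c; rewrite /refine; case: eqP => [->|_]; lra.
Qed.

Lemma inner_coord_gt0 t (v : inner t) c : 0 < inner_coord v c.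
Proof.
elim: t v c => [//|f IH] [[i v]|] c /=; last by rewrite invr_gt0.
have := IH i v i; have := IH i v c; rewrite /refine; case: ifP => _; lra.
Qed.

Lemma coord_ge0 t (x : net_graph t) c : 0 <= coord x c.
Proof. by case: x => [c'|v] /=; [case: eqP | exact/ltW/inner_coord_gt0]. Qed.

Lemma coord_eq0 t (x : net_graph t) c :
  coord x c = 0 -> exists2 a, x = inl a & a != c.
Proof.
case: x => [a|v] /= e; last by have := inner_coord_gt0 v c; rewrite e ltxx.
by exists a => //; apply/eqP => ac; move: e; rewrite ac eqxx => /eqP; rewrite oner_eq0.
Qed.

Lemma mix_ge0 t (x y : net_graph t) s c : 0 < s < 1 -> 0 <= mix s (coord x) (coord y) c.
Proof.
by move=> /andP[s0 s1]; rewrite /mix addr_ge0 // mulr_ge0 ?coord_ge0 //; lra.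
Qed.

(** Inner vertices have positive coordinates, so a vertex or an edge meets the
    side opposite to corner [c] only if it is part of that side. *)
Lemma mix_eq0 t (x y : net_graph t) s c : 0 < s < 1 ->
  mix s (coord x) (coord y) c = 0 ->
  exists a b, [/\ x = inl a, y = inl b, a != c & b != c].
Proof.
move=> /andP[s0 s1] /eqP; rewrite /mix paddr_eq0; first last.
- by rewrite mulr_ge0 ?coord_ge0 // ltW.
- by rewrite mulr_ge0 ?coord_ge0 // subr_ge0 ltW.
rewrite !mulf_eq0 subr_eq0 (gt_eqF s1) (gt_eqF s0) /=.
move=> /andP[/eqP/coord_eq0[a -> ac] /eqP/coord_eq0[b -> bc]].
by exists a, b.
Qed.

Lemma cell_face f (x y : net_graph (Insert f)) : (x == y) || adj x y ->
  exists i x' y', [/\ x = face (i := i) x', y = face (i := i) y'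
                    & (x' == y') || adj x' y'].
Proof.
case/orP=> [/eqP<-|xy].
  case: x => [c|[[i v]|]].
  - have [i ci] : exists i, c != i
      by elim/ord3_ind: c; (by exists o0) || (by exists o1).
    by exists i, (inl c), (inl c); rewrite /= (negPf ci) eqxx.
  - by exists i, (inr v), (inr v); rewrite eqxx.
  - by exists o0, (inl o0), (inl o0); rewrite eqxx.
have [i [x' [y' [ex ey]]]] := face_edge xy.
by exists i, x', y'; split=> //; move: xy; rewrite ex ey face_adj => ->; rewrite orbT.
Qed.

(** Different vertices and open edges are drawn disjointly; a vertex is treated
    as a degenerate edge, with [x = y].  A common point of two edges in the same
    new triangle is handled by induction.  If they lie in different ones, [i] and
    [j], then the point has equal and minimal coordinates [i] and [j], so it
    lies on the common side.  Hence the first edge is part of this side and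
    belongs to the [j]-th new triangle as well. *)
Lemma cells_disjoint t (x y u v : net_graph t) s r :
    (x == y) || adj x y -> (u == v) || adj u v -> 0 < s < 1 -> 0 < r < 1 ->
  mix s (coord x) (coord y) =1 mix r (coord u) (coord v) ->
  [set x; y]%SET = [set u; v]%SET.
Proof.
elim: t x y u v => [|f IH] x y u v xy uv s01 r01 e.
  have supp (a b : net_graph Empty) q c : 0 < q < 1 ->
      (inl c \in [set a; b]%SET) = (mix q (coord a) (coord b) c != 0).
    move=> q01; apply/idP/idP => [|].
      rewrite !inE; apply: contraL => /eqP/(mix_eq0 q01) [a' [b' [-> -> ac bc]]].
      by rewrite negb_or ![inl c == _]eq_sym; apply/andP; split;
         [apply: contra ac | apply: contra bc] => /eqP[->].
    rewrite !inE; case: a b => [a|//] [b|//] /=; rewrite /mix.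
    apply: contraNT; rewrite negb_or => /andP[ca cb].
    have -> : c == a = false by apply: contraNF ca => /eqP->.
    have -> : c == b = false by apply: contraNF cb => /eqP->.
    by rewrite !mulr0 addr0.
  by apply/setP => -[c|//]; rewrite (supp _ _ s) // (supp _ _ r) // e.
have [i [x' [y' [ex ey xy']]]] := cell_face xy.
have [j [u' [v' [eu ev uv']]]] := cell_face uv.
have ei c : mix s (coord x) (coord y) c = refine i (mix s (coord x') (coord y')) c.
  by rewrite -mix_refine /mix ex ey !coord_face.
have ej c : mix r (coord u) (coord v) c = refine j (mix r (coord u') (coord v')) c.
  by rewrite -mix_refine /mix eu ev !coord_face.
have same (x1 y1 : net_graph (f j)) : x = face x1 -> y = face y1 ->
    (x1 == y1) || adj x1 y1 -> [set x; y]%SET = [set u; v]%SET.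
  move=> ex1 ey1 xy1; rewrite ex1 ey1 eu ev.
  have := IH j x1 y1 u' v' xy1 uv' s01 r01; rewrite -!imset_set1 -!imsetU => -> //.
  apply: (@refine_inj j) => c; rewrite -ej -e -mix_refine /mix ex1 ey1.
  by rewrite !coord_face.
case: (i =P j) => [eij|/eqP nij].
  case: _ / eij u' v' eu ev uv' ej same x' y' ex ey xy' ei.
  by move=> u' v' _ _ _ _ same x' y' ex ey xy' _; exact: (same x' y').
have zero : mix s (coord x') (coord y') j = 0.
  have := e i; have := e j; rewrite !ei !ej /refine !eqxx eq_sym (negPf nij).
  have := mix_ge0 x' y' j s01; have := mix_ge0 u' v' i r01; lra.
have [a [b [ea eb aj bj]]] := mix_eq0 s01 zero.
(* On the common side, the centre is corner [i] of one triangle and [j] of the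
   other. *)
pose sw c := if c == i then j else c.
have fsw c : c != j ->
    face (i := i) (inl c) = face (i := j) (inl (sw c)) :> net_graph (Insert f).
  by rewrite /= /sw => cj; case: (c =P i) => _; rewrite ?eqxx // (negPf cj).
apply: (same (inl (sw a)) (inl (sw b))).
- by rewrite ex ea fsw.
- by rewrite ey eb fsw.
- by rewrite /=; case: (sw a =P sw b) => [->|]; rewrite ?eqxx //= orbT.
Qed.

Lemma coord_sum t (x : net_graph t) : coord x o0 + coord x o1 + coord x o2 = 1.
Proof.
case: x => [|v] /=; first by elim/ord3_ind; rewrite /= ?addr0 ?add0r.
elim: t v => [//|f IH] [[i v]|] /=; last by field.
have := IH i v; rewrite /refine; elim/ord3_ind: i v => v /=; lra.
Qed.

Lemma net_planar t : planar R (net_graph t).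
Proof.
pose pos (x : net_graph t) : R * R := (coord x o1, coord x o2).
pose arc x y (s : R) : R * R :=
  ((1 - s) * (pos x).1 + s * (pos y).1, (1 - s) * (pos x).2 + s * (pos y).2).
have cell x y u v s r : (x == y) || adj x y -> (u == v) || adj u v ->
    0 < s < 1 -> 0 < r < 1 ->
    arc x y s = arc u v r -> [set x; y]%SET = [set u; v]%SET.
  move=> xy uv s01 r01 [e1 e2]; apply: (cells_disjoint xy uv s01 r01).
  have sx := coord_sum x; have sy := coord_sum y.
  have su := coord_sum u; have sv := coord_sum v.
  apply: ord3_ind => //; rewrite /mix.
  have -> : coord x o0 = 1 - coord x o1 - coord x o2 by lra.
  have -> : coord y o0 = 1 - coord y o1 - coord y o2 by lra.
  have -> : coord u o0 = 1 - coord u o1 - coord u o2 by lra.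
  have -> : coord v o0 = 1 - coord v o1 - coord v o2 by lra.
  by rewrite /= in e1 e2; nra.
have half : 0 < (2^-1 : R) < (1 : R) by apply/andP; split; lra.
have arcxx x s : arc x x s = pos x by rewrite /arc /pos /=; congr pair; ring.
have pos_inj : injective pos.
  move=> x y exy; have := @cell x x y y _ _ _ _ half half.
  rewrite !eqxx !arcxx exy => /(_ isT isT erefl)/setP/(_ x).
  by rewrite !inE eqxx !orbb => /esym/eqP.
exists pos, arc; split=> //.
- move=> x y _; apply: continuous_subspaceT => s.
  have lin (a b : R) :
      ((fun r => (1 - r) * a + r * b) @ s --> (1 - s) * a + s * b)%classic.
    by apply: cvgD; apply: cvgMr_tmp => //; apply: cvgB; [exact: cvg_cst | exact: cvg_id].
  exact: (cvg_pair (lin _ _) (lin _ _)).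
- move=> x y xy s r _ _ [e1 e2].
  apply/eqP; rewrite -subr_eq0; apply: contraT => sr.
  have : pos x = pos y.
    rewrite /pos; congr pair; apply/eqP; rewrite -subr_eq0.
      by rewrite -(mulrI_eq0 _ (mulfI sr)); apply/eqP; move: e1 => /=; nra.
    by rewrite -(mulrI_eq0 _ (mulfI sr)); apply/eqP; move: e2 => /=; nra.
  by move=> /pos_inj exy; rewrite exy adj_irrefl in xy.
- by move=> x y _; rewrite /arc /pos /=; congr pair; ring.
- by move=> x y _; rewrite /arc /pos /=; congr pair; ring.
- by move=> x y _ s _; rewrite /arc /pos /=; congr pair; ring.
- move=> x y z xy s; rewrite in_itv /= => s01 e.
  have := @cell x y z z s 2^-1; rewrite xy orbT eqxx arcxx => /(_ isT isT s01 half e).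
  move=> exyz; have: x \in [set z; z]%SET by rewrite -exyz !inE eqxx.
  have: y \in [set z; z]%SET by rewrite -exyz !inE eqxx orbT.
  by rewrite !inE !orbb => /eqP ey /eqP ex; rewrite ex ey adj_irrefl in xy.
- move=> x y u v xy uv /eqP ne s r; rewrite !in_itv /= => s01 r01 e; apply: ne.
  by apply: (cell x y u v s r); rewrite ?xy ?uv ?orbT.
Qed.

End Drawing.

(** * Networks are 3-trees *)

Lemma isomorphic_sym G H : isomorphic G H -> isomorphic H G.
Proof.
move=> [h [[g gK hK] h_adj]]; exists g; split; first by exists h.
by move=> x y; rewrite -h_adj !hK.
Qed.

Lemma isomorphic_trans H G K : isomorphic G H -> isomorphic H K -> isomorphic G K.
Proof.
move=> [h [h_bij h_adj]] [g [g_bij g_adj]]; exists (g \o h).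
by split; [exact: bij_comp | move=> x y; rewrite /= g_adj h_adj].
Qed.

Lemma isomorphic_induced (G H : sgraph) (A : {set G}) (B : {set H}) (h : G -> H) :
    {in A &, injective h} -> B = h @: A ->
    {in A &, forall x y, adj (h x) (h y) = adj x y} ->
  isomorphic (induced_subgraph A) (induced_subgraph B).
Proof.
move=> h_inj eB h_adj.
have hB (x : {x | x \in A}) : h (val x) \in B by rewrite eB imset_f ?(valP x).
exists (fun x => exist _ (h (val x)) (hB x)); split; last first.
  by move=> [x xA] [y yA]; rewrite /= /induced_adj /= h_adj.
apply: inj_card_bij => [[x xA] [y yA] [/= e]|].
  by apply: val_inj; apply: h_inj.
by rewrite !card_sig eB card_in_imset.
Qed.

Lemma isomorphic_setT (G : sgraph) : isomorphic (induced_subgraph [set: G]) G.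
Proof.
exists val; split=> //; exists (fun x => exist _ x (finset.in_setT x)) => // x.
exact: val_inj.
Qed.

Lemma ktree_isomorphic k G H : isomorphic G H -> ktree k G -> ktree k H.
Proof.
move=> GH kG; elim: kG H GH => {G} [G GK H GH|G v NK _ IH H [h [h_bij h_adj]]].
  by apply: ktree_complete; apply: isomorphic_trans GK; apply: isomorphic_sym.
have [g gK hK] := h_bij.
have ind (A : {set G}) : isomorphic (induced_subgraph A) (induced_subgraph (h @: A)).
  apply: (@isomorphic_induced _ _ _ _ h) => // x y _ _.
  exact: (can_inj gK).
apply: (@ktree_extend k H (h v)).
  suff -> : neighbourhood (h v) = h @: neighbourhood v.
    by apply: isomorphic_trans NK; apply/isomorphic_sym/ind.
  apply/setP => y; rewrite -[y]hK (mem_imset _ _ (can_inj gK)) !inE; exact: h_adj.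
apply: IH; suff -> : ~: [set h v] = h @: ~: [set v] by exact: ind.
by apply/setP => y; rewrite -[y]hK (mem_imset _ _ (can_inj gK)) !inE (can_eq gK).
Qed.

(** The extension step of k-trees, relative to an induced subgraph of a fixed
    graph; this spares the transport along removals of vertices. *)
Lemma ktree_add_vertex k (G : sgraph) (A : {set G}) (v : G) : v \notin A ->
    isomorphic (induced_subgraph (neighbourhood v :&: A)) (complete_graph k) ->
    ktree k (induced_subgraph A) ->
  ktree k (induced_subgraph (v |: A)).
Proof.
move=> vA NK kA; have vvA : v \in v |: A by rewrite setU11.
pose w : induced_subgraph (v |: A) := exist _ v vvA.
pose h (x : induced_subgraph (v |: A)) : G := val x.
have h_inj : injective h by exact: val_inj.
apply: (@ktree_extend k _ w).
  apply: isomorphic_trans NK.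
  apply: (@isomorphic_induced _ _ _ _ h) => //; first by move=> x y _ _; exact: h_inj.
  apply/setP => x; apply/setIP/imsetP => [[]|[[y yA]]]; rewrite !inE.
    move=> vx xA; have xvA : x \in v |: A by rewrite setU1r.
    by exists (exist _ x xvA); rewrite // inE.
  rewrite /= /induced_adj /= => vy ->; split=> //; rewrite /h /=.
  by case/setU1P: (yA) vy => // ->; rewrite adj_irrefl.
apply: ktree_isomorphic kA; apply: isomorphic_sym.
apply: (@isomorphic_induced _ _ _ _ h) => //; first by move=> x y _ _; exact: h_inj.
apply/setP => x; apply/idP/imsetP => [xA|[[y yA]]].
  have xvA : x \in v |: A by rewrite setU1r.
  exists (exist _ x xvA) => //; rewrite !inE -val_eqE /=.
  by apply: contraNneq vA => <-.
rewrite !inE -val_eqE /= => yv ->; rewrite /h /=.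
by case/setU1P: (yA) yv => // ->; rewrite eqxx.
Qed.

Lemma isomorphic_triangle (G : sgraph) (g : 'I_3 -> G) : injective g ->
    (forall c c', adj (g c) (g c') = (c != c')) ->
  isomorphic (induced_subgraph (g @: [set: 'I_3])) (complete_graph 3).
Proof.
move=> g_inj g_adj; apply: isomorphic_trans (isomorphic_setT _).
apply: isomorphic_sym.
apply: (@isomorphic_induced (complete_graph 3) G [set: 'I_3] _ g) => //.
by move=> c c' _ _; exact: g_inj.
Qed.

(** Adding the inner vertices of a triangle whose corners are already present,
    the centre before the three new triangles.  The hypothesis on neighbours
    says that the triangle is still empty as far as [A] is concerned: then every
    vertex is adjacent, when it is added, to three corners only. *)
Lemma ktree_add_face t (G : sgraph) (h : net_graph t -> G) (A : {set G}) :
    injective h -> (forall x y, adj (h x) (h y) = adj x y) ->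
    (forall c, h (inl c) \in A) -> (forall v, h (inr v) \notin A) ->
    (forall v x, x \in A -> adj (h (inr v)) x -> exists c, x = h (inl c)) ->
  ktree 3 (induced_subgraph A) ->
  ktree 3 (induced_subgraph (A :|: [set h (inr v) | v in inner t])).
Proof.
elim: t G h A => [|f IH] G h A h_inj h_adj hA hnA h_sep kA.
  suff -> : A :|: [set h (inr v) | v in inner Empty] = A by [].
  by apply/setP => x; rewrite !inE orb_idr // => /imsetP[[]].
(* [A] together with the centre and the new triangles in the list [l] *)
pose B l := (h (inr None) |: A) :|:
  \bigcup_(i <- l) [set h (face (inr v)) | v in inner (f i)].
have kB l : uniq l -> ktree 3 (induced_subgraph (B l)).
  elim: l => [_|i l IHl /= /andP[il l_uniq]].
    rewrite /B big_nil finset.setU0; apply: ktree_add_vertex => //.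
    suff -> : neighbourhood (h (inr None)) :&: A = (h \o inl) @: [set: 'I_3].
      apply: isomorphic_triangle => [c c' /h_inj[]//|c c'].
      by rewrite /= h_adj.
    apply/setP => x; rewrite !inE; apply/andP/imsetP => [[dx xA]|[c _ ->]].
      by have [c ->] := h_sep _ _ xA dx; exists c; rewrite ?inE.
    by rewrite /= h_adj.
  have -> : B (i :: l) = B l :|: [set h (face (inr v)) | v in inner (f i)].
    by rewrite /B big_cons finset.setUCA finset.setUC.
  have memB x : x \in B l -> [\/ x \in A, x = h (inr None) |
       exists j w, j != i /\ x = h (face (i := j) (inr w))].
    rewrite !inE => /orP[/orP[/eqP|]|]; [by constructor 2|by constructor 1|].
    rewrite finset.bigcup_seq => /finset.bigcupP[j /= jl] /imsetP[w _ ->].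
    constructor 3; exists j, w.
    by split=> //; apply: contraNneq il => <-.
  apply: (IH i G (h \o @face f i) (B l)).
  - by move=> x y /h_inj/face_inj.
  - by move=> x y; rewrite /= h_adj face_adj.
  - by move=> c; rewrite !inE /=; case: ifP => _; rewrite ?eqxx ?hA ?orbT.
  - move=> v; apply/negP => /memB[xA|/h_inj//|[j [w [ji /h_inj[]]]]].
      by have := hnA (face_in v); rewrite xA.
    by move=> eji; rewrite eji eqxx in ji.
  - move=> v x /memB[xA|->|[j [w [ji ->]]]]; rewrite /= ?h_adj.
    + move=> vx; have [c ec] := h_sep _ _ xA vx; move: vx; rewrite ec h_adj.
      case/face_closed => -[c'|//] e; by exists c'; rewrite e.
    + by exists i; rewrite /= eqxx.
    + by case/andP => /eqP /= eij _; rewrite eij eqxx in ji.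
  - exact: IHl.
suff -> : A :|: [set h (inr v) | v in inner (Insert f)] = B (enum 'I_3).
  by apply: kB; exact: enum_uniq.
apply/setP => x; rewrite !inE.
apply/orP/orP => [[xA|/imsetP[[[i v]|] _ ->]]|[/orP[/eqP->|xA]|]].
- by left; rewrite xA orbT.
- right; rewrite finset.bigcup_seq; apply/finset.bigcupP; exists i; rewrite ?mem_enum //.
  by apply/imsetP; exists v.
- by left; rewrite eqxx.
- by right; apply/imsetP; exists None.
- by left.
- rewrite finset.bigcup_seq => /finset.bigcupP[i _ /imsetP[v _ ->]]; right.
  by apply/imsetP; exists (face_in v).
Qed.

Lemma net_ktree t : ktree 3 (net_graph t).
Proof.
have inlA (c : 'I_3) : (inl c : net_graph t) \in inl @: [set: 'I_3] by rewrite imset_f.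
have := @ktree_add_face t (net_graph t) id (inl @: [set: 'I_3]).
have -> : inl @: [set: 'I_3] :|: [set inr v | v in inner t] = [set: net_graph t].
  apply/setP => -[c|v]; rewrite !inE; first by rewrite inlA.
  by apply/orP; right; apply/imsetP; exists v.
move=> add; apply: ktree_isomorphic (isomorphic_setT _) _; apply: add => //.
- by move=> v; apply/imsetP => -[].
- by move=> v x /imsetP[c _ ->] _; exists c.
- apply: ktree_complete; apply: isomorphic_triangle => //.
  by move=> c c' [].
Qed.

(** * Toughness *)

Lemma connect_homo (T U : finType) (e : rel T) (e' : rel U) (h : T -> U) :
    (forall x y, e x y -> e' (h x) (h y)) ->
  forall x y, connect e x y -> connect e' (h x) (h y).
Proof.
move=> he x y /connectP[p]; elim: p x => [|z p IH] x /=; first by move=> _ ->.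
by case/andP=> xz zp ey; apply: connect_trans (connect1 (he _ _ xz)) (IH _ zp ey).
Qed.

Definition avoiding (G : sgraph) (D : pred G) : rel G :=
  fun x y => [&& adj x y, ~~ D x & ~~ D y].

(** A set of vertices that meets every component bounds their number.  Upper
    bounds in this form can be combined without naming the components. *)
Lemma components_le (G : sgraph) (X : {set G}) (L : seq G) :
    (forall v, v \notin X ->
       exists2 y, y \in L & connect (avoiding (mem X)) v y) ->
  (components (induced_subgraph (~: X)) <= size L)%N.
Proof.
move=> cov; set H := induced_subgraph _.
have H_sym : connect_sym (@adj H) by apply: sym_connect_sym; exact: adj_sym.
have lift (x : H) y : connect (avoiding (mem X)) (val x) y ->
    exists2 z : H, val z = y & connect (@adj H) x z.
  case/connectP=> p; elim: p x => [|z p IH] x /=; first by move=> _ ->; exists x.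
  case/andP=> /and3P[xz _ zX] zp ey.
  have zA : z \in ~: X by rewrite inE.
  have [w we zw] := IH (exist _ z zA) zp ey; exists w => //.
  by apply: connect_trans zw; apply: connect1.
pose L' : seq H := pmap insub L.
apply: (@leq_trans (size (map (fingraph.root (@adj H)) L'))); last first.
  by rewrite size_map size_pmap count_size.
apply: leq_trans (card_size _); apply: subset_leq_card; apply/fintype.subsetP => r.
rewrite !inE andbT => /eqP r_root.
have rX : val r \notin X by have := valP r; rewrite inE.
have [y yL ry] := cov _ rX; have [z ez rz] := lift _ _ ry.
apply/mapP; exists z; last by rewrite -[LHS]r_root; apply/eqP; rewrite root_connect.
by rewrite mem_pmap; apply/mapP; exists y => //; rewrite -ez valK.
Qed.

Notation center f := (inr None : net_graph (Insert f)).

Lemma card_inner f (P : pred (inner (Insert f))) :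
  #|P| = (P None + \sum_(i < 3) #|[pred v | P (@face_in f i v)]|)%N.
Proof.
pose E i := [seq @face_in f i v | v <- enum [pred v | P (@face_in f i v)]].
pose s := nseq (P None) None ++ flatten [seq E i | i <- enum 'I_3].
have memE i v : (v \in E i) = P v && (if v is Some u then tag u == i else false).
  apply/mapP/andP => [[w]|[Pv]]; first by rewrite mem_enum inE => Pw -> /=.
  case: v Pv => // -[j w] Pv /= /eqP e; case: _ / e.
  by exists w; rewrite // mem_enum.
have mem_s : s =i P.
  move=> v; rewrite mem_cat mem_nseq unfold_in /=; apply/orP/idP => [[]|Pv].
  - by case: (boolP (P None)) => //= PN /eqP->.
  - by case/flatten_mapP=> i _; rewrite memE => /andP[].
  - case: v Pv => [[i w]|] Pv; last by left; rewrite (Pv : P None).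
    right; apply/flatten_mapP; exists i; first by rewrite mem_enum.
    by rewrite memE (Pv : P (Some _)) /=.
have s_uniq : uniq s.
  rewrite cat_uniq; apply/and3P; split; first by case: (P None).
    apply/hasPn => v /flatten_mapP[i _]; rewrite memE mem_nseq; case: v => [u|].
      by rewrite andbF.
    by rewrite andbF.
  have : uniq (enum 'I_3) by exact: enum_uniq.
  elim: (enum 'I_3) => //= i l IHl /andP[il l_uniq]; rewrite cat_uniq IHl // andbT.
  rewrite (map_inj_uniq (@face_in_inj f i)) enum_uniq /=.
  apply/hasPn => v /flatten_mapP[j jl]; rewrite !memE => /andP[_].
  case: v => // u /eqP ej; apply/negP => /andP[_ /eqP ei].
  by move: il; rewrite -ei ej jl.
rewrite -(eq_card mem_s) (card_uniqP s_uniq) size_cat size_nseq; congr addn.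
rewrite size_flatten /shape -map_comp sumnE big_map -big_enum.
by apply: eq_bigr => i _; rewrite /= size_map -cardE.
Qed.

Section Covers.
Variable t : network.

Definition removed (D : pred (net_graph t)) : nat := #|[pred v | D (inr v)]|.

(** Representatives of the components that avoid the remaining corners. *)
Definition covers (D : pred (net_graph t)) (r : seq (inner t)) : Prop :=
  forall v, ~~ D (inr v) -> exists y, connect (avoiding D) (inr v) y /\
    match y with inl c => ~~ D (inl c) | inr w => w \in r end.

(** [e] bounds the excess for the set [S] of removed corners: the components cut
    off from the other corners are at most [e] more than the removed inner
    vertices. *)
Definition scatters (S : pred 'I_3) (e : nat) : Prop :=
  forall D : pred (net_graph t), (forall c, D (inl c) = S c) ->
  exists2 r, covers D r & (size r <= removed D + e)%N.

(** With all corners present, removing inner vertices cuts off fewer components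
    than there are removed vertices.  The bound [scatters t pred0 0] is too weak
    here, since the component of the corners counts as well. *)
Definition unshattered : Prop :=
  forall D : pred (net_graph t), (forall c, D (inl c) = false) ->
  exists2 r, covers D r & (size r + (0 < removed D) <= removed D)%N.

End Covers.

Definition put (S : pred 'I_3) (i : 'I_3) (b : bool) : pred 'I_3 :=
  fun c => if c == i then b else S c.

Section CoversInsert.
Variables (f : 'I_3 -> network) (D : pred (net_graph (Insert f))).

Definition restrict i : pred (net_graph (f i)) := fun x => D (face x).

Arguments restrict : clear implicits.

Lemma restrict_corner S i : (forall c, D (inl c) = S c) ->
  forall c, restrict i (inl c) = put S i (D (center f)) c.
Proof. by move=> DS c; rewrite /restrict /put /=; case: ifP => // _; rewrite DS. Qed.

Lemma removed_insert :
  removed D = (D (center f) + \sum_(i < 3) removed (restrict i))%N.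
Proof. exact: card_inner. Qed.

(** A component that reaches the centre also reaches the remaining corners, if
    there are any; only if all corners are removed and the centre is not does
    the centre need a representative of its own. *)
Lemma covers_insert (r : forall i, seq (inner (f i))) :
    (forall i, covers (restrict i) (r i)) ->
  exists2 s, covers D s &
    size s = (~~ D (center f) && [forall c, D (inl c)] + \sum_(i < 3) size (r i))%N.
Proof.
move=> cov; pose b := ~~ D (center f) && [forall c, D (inl c)].
exists (nseq b None ++ flatten [seq map (@face_in f i) (r i) | i <- enum 'I_3]);
  last first.
  rewrite size_cat size_nseq size_flatten /shape -map_comp sumnE big_map -big_enum.
  by congr addn; apply: eq_bigr => i _; rewrite /= size_map.
have cov_center : ~~ D (center f) -> exists y, connect (avoiding D) (center f) y /\
    match y with inl c => ~~ D (inl c) | inr w => w \in nseq b None ++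
      flatten [seq map (@face_in f i) (r i) | i <- enum 'I_3] end.
  move=> dD; case: (boolP [forall c, D (inl c)]) => [allD|/forallPn[c cD]].
    by exists (inr None); split=> //; rewrite /b dD allD mem_cat inE.
  by exists (inl c); split=> //; apply: connect1; rewrite /avoiding dD cD.
have up i x y : connect (avoiding (restrict i)) x y ->
    connect (avoiding D) (face x) (face y).
  by apply: connect_homo => {}x {}y; rewrite /avoiding face_adj.
case=> [[i v]|] vD; last exact: cov_center.
have [y [/up vy]] := cov i v vD.
case: y vy => [c|w] /= vy.
  rewrite /restrict /= in vy *; case: (c =P i) vy => [_|_] vy yD.
    have [z [yz zP]] := cov_center yD.
    by exists z; split=> //; exact: connect_trans vy yz.
  by exists (inl c).
move=> wr; exists (inr (face_in w)); split=> //.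
rewrite mem_cat; apply/orP; right; apply/flatten_mapP.
by exists i; rewrite ?mem_enum // map_f.
Qed.

End CoversInsert.

Arguments restrict {f} D i x.

(** The maximum distinguishes whether the centre, which is corner [i] of the
    [i]-th new triangle, is removed.  If so, it pays for one component.  The
    truncation of the predecessor at 0 only weakens the bound. *)
Lemma scatters_insert f (e : 'I_3 -> pred 'I_3 -> nat) S :
    (forall i S', scatters (f i) S' (e i S')) ->
  scatters (Insert f) S
    (maxn (\sum_(i < 3) e i (put S i true)).-1
          ([forall c, S c] + \sum_(i < 3) e i (put S i false))).
Proof.
move=> sc D DS.
have [r r_cov r_size] := fin_all_exists2 (fun i => sc i _ _ (restrict_corner i DS)).
have [s s_cov s_size] := covers_insert r_cov.
have le_sum : (\sum_(i < 3) size (r i) <= \sum_(i < 3) removed (restrict D i)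
               + \sum_(i < 3) e i (put S i (D (center f))))%N.
  by rewrite -big_split; exact: leq_sum.
exists s => //; rewrite s_size removed_insert (eq_forallb DS).
by case: (D _) le_sum => /=; lia.
Qed.

(** If the centre is removed, then each new triangle has lost one corner, and
    excess 0 for this corner leaves the centre as the surplus vertex. *)
Lemma unshattered_insert f :
    (forall i, unshattered (f i)) -> (forall i, scatters (f i) (pred1 i) 0) ->
  unshattered (Insert f).
Proof.
move=> un sc D D0; have [dD|dD] := boolP (D (center f)).
  have D1 i c : restrict D i (inl c) = pred1 i c.
    by rewrite (restrict_corner i D0) /put dD /=; case: ifP.
  have [r r_cov r_size] := fin_all_exists2 (fun i => sc i _ (D1 i)).
  have [s s_cov s_size] := covers_insert r_cov.
  have le_sum : (\sum_(i < 3) size (r i) <= \sum_(i < 3) removed (restrict D i))%N.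
    by apply: leq_sum => i _; rewrite (leq_trans (r_size i)) ?addn0.
  by exists s => //; rewrite s_size removed_insert dD /= add0n addnC leq_add2l.
have D1 i c : restrict D i (inl c) = false.
  by rewrite (restrict_corner i D0) /put (negPf dD); case: ifP.
have [r r_cov r_size] := fin_all_exists2 (fun i => un i _ (D1 i)).
have [s s_cov s_size] := covers_insert r_cov.
exists s => //; rewrite s_size removed_insert (negPf dD) /= add0n.
have -> : [forall c, D (inl c)] = false.
  by apply/forallP => /(_ o0); rewrite D0.
have := @leq_sum _ (index_enum 'I_3) predT _ _ (fun i _ => r_size i).
rewrite big_split /= => le_sum; rewrite add0n.
apply: leq_trans le_sum; rewrite leq_add2l.
case: posnP => //; rewrite lt0n sum_nat_eq0 => /forallPn[i].
by rewrite implyTb -lt0n => i0; rewrite (bigD1 i) //= i0.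
Qed.

Lemma scatters_empty S e : scatters Empty S e.
Proof. by move=> D _; exists [::] => // -[]. Qed.

Lemma unshattered_empty : unshattered Empty.
Proof.
by move=> D _; exists [::] => [[]//|]; rewrite /removed eq_card0 // => -[].
Qed.

(** Some corner remains: the components are that of the corners and those cut
    off from it, whose number is at most that of the removed inner vertices, or
    less if no corner is removed.  No corner remains: there is at most one
    component more than there are removed inner vertices, and the corners pay
    for it. *)
Lemma net_tough t : unshattered t ->
    (forall S, scatters t S [forall c, S c]) ->
  forall R : realType, tough (1 : R) (net_graph t).
Proof.
move=> un sc R; rewrite /tough /toughness; apply: le_bigmin => [|X sepX].
  by rewrite leey.
rewrite lee_fin; set k := components _.
have k_gt0 : (0 : R) < k%:R by rewrite ltr0n; apply: leq_trans sepX.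
rewrite ler_pdivlMr // mul1r ler_nat.
pose D : pred (net_graph t) := mem X; pose S : pred 'I_3 := fun c => D (inl c).
have cardX : #|X| = (#|S| + removed D)%N.
  rewrite -sum1_card big_sumType /= !sum1dep_card; congr addn; apply: eq_card => c;
    by rewrite !inE.
have [c0 /= c0X|all_removed] := pickP (predC S); last first.
  have S_all : forall c, S c by move=> c; have := all_removed c; rewrite /= => /negbFE.
  have [r r_cov r_size] := sc S D (fun=> erefl).
  apply: (@leq_trans (size (map inr r : seq (net_graph t)))).
    apply: components_le => -[c|v] vX; first by rewrite [_ \in X]S_all in vX.
    have [[c|w] [vy yP]] := r_cov v vX; first by rewrite [D _]S_all in yP.
    by exists (inr w) => //; rewrite map_f.
  have S_all1 : [forall c, S c] = true by apply/forallP.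
  rewrite S_all1 in r_size; rewrite size_map cardX addnC (leq_trans r_size) // leq_add2l.
  by rewrite lt0n; apply/pred0Pn; exists o0; exact: S_all.
have cov_le r : covers D r -> (k <= (size r).+1)%N.
  move=> r_cov; pose L : seq (net_graph t) := inl c0 :: map inr r.
  apply: (@leq_trans (size L)); last by rewrite /= size_map.
  apply: components_le.
  have corner c : c \notin S -> connect (avoiding (mem X)) (inl c : net_graph t) (inl c0).
    move=> cX; have [->//|c_c0] := eqVneq c c0.
    by apply: connect1; apply/and3P.
  move=> [c|v] vX; first by exists (inl c0); rewrite ?mem_head //; exact: corner.
  have [[c|w] [vy yP]] := r_cov v vX; last by exists (inr w); rewrite // inE map_f ?orbT.
  by exists (inl c0); rewrite ?mem_head //; apply: connect_trans vy (corner _ yP).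
have [c1 /= c1X|none] := pickP S.
  have [r r_cov r_size] := sc S D (fun=> erefl).
  have S_all : [forall c, S c] = false by apply/forallP => /(_ c0); apply/negP.
  apply: leq_trans (cov_le r r_cov) _; rewrite cardX -add1n leq_add //.
    by rewrite lt0n; apply/pred0Pn; exists c1.
  by rewrite S_all addn0 in r_size.
have [r r_cov r_size] := un D none.
have := leq_trans sepX (cov_le r r_cov); have := cov_le r r_cov; rewrite cardX.
by rewrite eq_card0 //; case: (removed D) r_size => [|n] /=; lia.
Qed.

(** * Paths between the corners *)

(* Keeps adjacency in new triangles in a form to which [face_adj] applies. *)
Local Arguments adj : simpl never.

Definition seg t (i j : 'I_3) (s : seq (inner t)) : bool :=
  path (@adj (net_graph t)) (inl i) (rcons (map inr s) (inl j)) && uniq s.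

(** [a k] bounds the inner vertices on a path between the two corners other than
    [k] that avoids [k]; [b k] bounds them on a path between these corners by way
    of [k], which is a pair of disjoint segments.  Since a path visits a corner
    once, no other intersections of it with the inside of a triangle occur when
    it starts and ends outside. *)
Definition bounded t (a b : 'I_3 -> nat) : Prop :=
  forall i j k, uniq [:: i; j; k] ->
    (forall s : seq (inner t), seg i j s -> (size s <= a k)%N) /\
    (forall s1 s2 : seq (inner t), seg i k s1 -> seg k j s2 -> uniq (s1 ++ s2) ->
       (size s1 + size s2 <= b k)%N).

Lemma seg_nil t (i j : 'I_3) : seg (t := t) i j [::] = (i != j).
Proof. by rewrite /seg /= !andbT. Qed.

Lemma seg_uniq t (i j : 'I_3) (s : seq (inner t)) : seg i j s -> uniq s.
Proof. by case/andP. Qed.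

Lemma seg_rev t (i j : 'I_3) (s : seq (inner t)) : seg i j s -> seg j i (rev s).
Proof.
case/andP=> p u; rewrite /seg rev_uniq u andbT.
have := rev_path (@adj (net_graph t)) (inl i) (rcons (map inr s) (inl j)).
rewrite last_rcons belast_rcons rev_cons map_rev => ->.
by rewrite (@eq_path _ _ (@adj (net_graph t))) // => x y; rewrite /= adj_sym.
Qed.

Lemma uniq3C (i j k : 'I_3) : uniq [:: i; j; k] -> uniq [:: j; i; k].
Proof. by rewrite (perm_uniq (permEl (perm_catCA [:: i] [:: j] [:: k]))). Qed.

Lemma uniq3_rot (i j k : 'I_3) : uniq [:: i; j; k] -> uniq [:: j; k; i].
Proof. by rewrite -(rot_uniq 1). Qed.

Lemma uniq_around (T : eqType) (s1 s2 : seq T) x :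
  uniq (s1 ++ x :: s2) -> uniq (s1 ++ s2).
Proof. by apply: subseq_uniq; rewrite cat_subseq ?subseq_refl ?subseq_cons. Qed.

Section InsertPaths.
Variable f : 'I_3 -> network.
Let G := net_graph (Insert f).

Lemma path_from_face i (w : inner (f i)) (s : seq (inner (Insert f))) (y : G) :
    None \notin s -> path (@adj G) (face (inr w)) (rcons (map inr s) y) ->
  exists s' y', [/\ s = map (@face_in f i) s', y = face y' &
                    path (@adj (net_graph (f i))) (inr w) (rcons (map inr s') y')].
Proof.
elim: s w => [|v s IH] w /=.
  move=> _ /andP[wy _]; have [y' ey] := face_closed wy.
  exists [::], y'; split=> //; apply/andP; split=> //.
  by have <- := @face_adj f i (inr w) y'; rewrite -ey.
rewrite inE negb_or => /andP[Nv Ns] /andP[wv sy].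
have [[c|v'] ev] := face_closed wv; first by move: ev Nv => /=; case: ifP => // _ [->].
have {}ev : v = face_in v' by case: ev.
rewrite ev in wv sy *; have [s' [y' [-> -> s'y']]] := IH v' Ns sy.
exists (v' :: s'), y'; split=> //; apply/andP; split=> //.
by have <- := @face_adj f i (inr w) (inr v').
Qed.

(** Between its ends, a path that avoids the corners and the centre cannot change
    from one new triangle to another. *)
Lemma path_in_face (s : seq (inner (Insert f))) (x y : G) :
    None \notin s -> s != [::] -> path (@adj G) x (rcons (map inr s) y) ->
  exists i s' x' y', [/\ s = map (@face_in f i) s', x = face x', y = face y' &
                         path (@adj (net_graph (f i))) x' (rcons (map inr s') y')].
Proof.
case: s => [//|[[i w]|] s]; rewrite inE negb_or //= => Ns _ /andP[xw sy].
have [s' [y' [-> -> s'y']]] := path_from_face Ns sy.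
rewrite adj_sym in xw; have [x' ex] := face_closed xw.
exists i, (w :: s'), x', y'; split=> //; apply/andP; split=> //.
by rewrite adj_sym; have <- := @face_adj f i (inr w) x'; rewrite -ex.
Qed.

Lemma face_eq_corner i (x : net_graph (f i)) c : inl c = face x -> x = inl c /\ i != c.
Proof. by case: x => [c'|//] /=; case: eqP => // /eqP ci [->]; rewrite eq_sym. Qed.

Lemma face_eq_center i (x : net_graph (f i)) : center f = face x -> x = inl i.
Proof. by case: x => [c'|//] /=; case: eqP => [->|]. Qed.

Lemma uniq_face_in i (s : seq (inner (f i))) : uniq (map (@face_in f i) s) = uniq s.
Proof. exact: map_inj_uniq (@face_in_inj f i) s. Qed.

(** For the empty segment [m] is arbitrary; allowing it in any new triangle
    avoids a separate case later. *)
Lemma seg_corner_center s i : None \notin s -> uniq s ->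
    path (@adj G) (inl i) (rcons (map inr s) (center f)) ->
  exists m s', [/\ m != i, s = map (@face_in f m) s' & seg i m s'].
Proof.
move=> Ns s_uniq; have [-> _|s0] := eqVneq s [::].
  have [m mi] : exists m, m != i by elim/ord3_ind: i; (by exists o0) || (by exists o1).
  by exists m, [::]; split=> //; rewrite seg_nil eq_sym.
move/(path_in_face Ns s0).
move=> [m [s' [x' [y' [es /face_eq_corner[ex mi] /face_eq_center ey]]]]].
rewrite ex ey => p; exists m, s'; split=> //.
by rewrite /seg p -uniq_face_in -es.
Qed.

Lemma seg_center_corner s i : None \notin s -> uniq s ->
    path (@adj G) (center f) (rcons (map inr s) (inl i)) ->
  exists m s', [/\ m != i, s = map (@face_in f m) s' & seg m i s'].
Proof.
move=> Ns s_uniq; have [-> _|s0] := eqVneq s [::].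
  have [m mi] : exists m, m != i by elim/ord3_ind: i; (by exists o0) || (by exists o1).
  by exists m, [::]; split=> //; rewrite seg_nil.
move/(path_in_face Ns s0).
move=> [m [s' [x' [y' [es /face_eq_center ex /face_eq_corner[ey mi]]]]]].
rewrite ex ey => p; exists m, s'; split=> //.
by rewrite /seg p -uniq_face_in -es.
Qed.

Lemma other3 (i j k m : 'I_3) : uniq [:: i; j; k] -> m != i -> m = j \/ m = k.
Proof.
by elim/ord3_ind: i; elim/ord3_ind: j => //; elim/ord3_ind: k => //;
   elim/ord3_ind: m => // _ _; by [left | right].
Qed.

Lemma seg_corner_corner (s : seq (inner (Insert f))) i j k :
    uniq [:: i; j; k] -> None \notin s -> seg i j s ->
  exists2 s', s = map (@face_in f k) s' & seg i j s'.
Proof.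
move=> ijk Ns /andP[p s_uniq]; have [->|s0] := eqVneq s [::].
  by exists [::] => //; case/and3P: ijk; rewrite seg_nil inE negb_or => /andP[].
have [m [s' [x' [y' [es /face_eq_corner[ex mi] /face_eq_corner[ey mj] p']]]]] :=
  path_in_face Ns s0 p.
have mk : m = k by case: (other3 ijk mi) => // e; rewrite e eqxx in mj.
by case: _ / mk s' x' y' es ex ey p' {mi mj ijk} => s' x' y' es -> -> p';
   exists s' => //; rewrite /seg p' -uniq_face_in -es.
Qed.

Lemma seg_split (s : seq (inner (Insert f))) i j : None \in s -> seg i j s ->
  exists m n s1 s2, [/\ m != i, n != j,
    s = map (@face_in f m) s1 ++ None :: map (@face_in f n) s2,
    seg i m s1 & seg n j s2].
Proof.
case/path.splitPr=> s1 s2; rewrite /seg map_cat -cats1 -catA cat_path /=.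
rewrite cat_uniq /= negb_or.
case/andP=> /and3P[p1 c p2] /and3P[u1 /andP[N1 dis] /andP[N2 u2]].
have q1 : path (@adj G) (inl i) (rcons (map inr s1) (center f)).
  by rewrite rcons_path p1.
have q2 : path (@adj G) (center f) (rcons (map inr s2) (inl j)) by rewrite -cats1.
have [m [s1' [mi -> ms1]]] := seg_corner_center N1 u1 q1.
have [n [s2' [nj -> ns2]]] := seg_center_corner N2 u2 q2.
by exists m, n, s1', s2'.
Qed.

End InsertPaths.

Definition maxs (l : seq nat) := foldr maxn 0%N l.

Lemma nth_le_maxs l n : (nth 0 l n <= maxs l)%N.
Proof. by elim: l n => [|x l IH] [|n] //=; rewrite leq_max ?leqnn ?IH ?orbT. Qed.

Lemma maxs_catC l1 l2 : maxs (l1 ++ l2) = maxs (l2 ++ l1).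
Proof.
have cat l l' : maxs (l ++ l') = maxn (maxs l) (maxs l').
  by elim: l => [|x l IH] /=; rewrite ?max0n // IH maxnA.
by rewrite !cat maxnC.
Qed.

Section Recursion.
Variables a b : 'I_3 -> 'I_3 -> nat.

(** The ways in which a path from [i] to [j] that avoids [k] can use the new
    triangles: it misses the centre and stays in triangle [k]; it visits the
    centre and uses triangle [k] before and after; it runs to the centre in
    triangle [j] and then on in triangle [i] or [k].  The remaining case is the
    last one for the reversed path. *)
Definition directs i j k :=
  [:: a k k; b k k; a j k + a i k; a j k + a k i]%N.

(** The ways in which a path from [i] by way of [k] to [j] can use the new
    triangles, if it visits the centre before [k] or not at all.  The segment
    between [i] and the centre lies in triangle [j] or [k], that between the
    centre and [k] in [i] or [j], and that between [k] and [j] in [i]; two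
    segments in the same triangle share a corner and form a path by way of it. *)
Definition vias i j k :=
  [:: a j j + a i i; a j k + b i k; b j j + a i i; a k j + b i k;
      a k j + a j i + a i i]%N.

Definition direct_bound i j k := maxs (directs i j k ++ directs j i k).

Definition via_bound i j k := maxs (vias i j k ++ vias j i k).

Lemma direct_boundC i j k : direct_bound i j k = direct_bound j i k.
Proof. exact: maxs_catC. Qed.

Lemma via_boundC i j k : via_bound i j k = via_bound j i k.
Proof. exact: maxs_catC. Qed.

Variable f : 'I_3 -> network.
Hypothesis ab : forall i, bounded (f i) (a i) (b i).

Lemma direct_insert i j k (s : seq (inner (Insert f))) : uniq [:: i; j; k] ->
  seg i j s -> (size s <= (direct_bound i j k).+1)%N.
Proof.
move=> ijk ij_s; have := nth_le_maxs (directs i j k ++ directs j i k).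
rewrite -/(direct_bound i j k); move: (direct_bound i j k) => X M.
have A m p q r u := (@ab m p q r u).1.
have B m p q r u := (@ab m p q r u).2.
have [Ns|Ns] := boolP (None \in s); last first.
  have [s' -> s'P] := seg_corner_corner ijk Ns ij_s.
  by rewrite size_map ltnW // ltnS; exact: leq_trans (A _ _ _ _ ijk _ s'P) (M 0).
have [m [n [s1 [s2 [mi nj es is1 s2j]]]]] := seg_split Ns ij_s.
have := seg_uniq ij_s; rewrite es size_cat /= !size_map addnS ltnS => /uniq_around u12.
have jki := uniq3_rot ijk; have kij := uniq3_rot jki.
case: (other3 ijk mi) => em; case: (other3 (uniq3C ijk) nj) => en; subst m n.
- exact: leq_trans (leq_add (A _ _ _ _ ijk _ is1) (A _ _ _ _ ijk _ s2j)) (M 2).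
- exact: leq_trans (leq_add (A _ _ _ _ ijk _ is1) (A _ _ _ _ (uniq3C jki) _ s2j)) (M 3).
- apply: leq_trans (M 7); rewrite addnC.
  exact: leq_add (A _ _ _ _ ijk _ s2j) (A _ _ _ _ (uniq3C kij) _ is1).
- move: u12; rewrite -map_cat uniq_face_in => u12.
  exact: leq_trans (B _ _ _ _ ijk _ _ is1 s2j u12) (M 1).
Qed.

Lemma via_insert_center i j k (s1 s2 : seq (inner (Insert f))) :
    uniq [:: i; j; k] -> None \in s1 -> seg i k s1 -> seg k j s2 ->
    uniq (s1 ++ s2) ->
  (size s1 + size s2 <= (via_bound i j k).+1)%N.
Proof.
move=> ijk Ns1 ik_s1 kj_s2 u12; have := nth_le_maxs (vias i j k ++ vias j i k).
rewrite -/(via_bound i j k); move: (via_bound i j k) => X M.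
have A m p q r u := (@ab m p q r u).1.
have B m p q r u := (@ab m p q r u).2.
have jki := uniq3_rot ijk; have kij := uniq3_rot jki.
have kji := uniq3C jki; have ikj := uniq3C kij.
have Ns2 : None \notin s2.
  move: u12; rewrite cat_uniq => /and3P[_ /hasPn dis _].
  by apply/negP => /dis; rewrite /= Ns1.
have [s2' es2 kj_s2'] := seg_corner_corner kji Ns2 kj_s2.
have [m [n [p [q [mi nk es1 ip qk]]]]] := seg_split Ns1 ik_s1.
have := seg_uniq ik_s1; rewrite es1 => /uniq_around upq.
have uqs : uniq (map (@face_in f n) q ++ map (@face_in f i) s2').
  by move: u12; rewrite es1 es2 -catA cat_uniq => /and3P[_ _ /andP[_]].
rewrite es2 size_cat /= !size_map addnS addSn ltnS.
case: (other3 ijk mi) => em; case: (other3 kij nk) => en; subst m n.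
- move: uqs; rewrite -map_cat uniq_face_in -addnA => uqs.
  exact: leq_trans (leq_add (A _ _ _ _ ijk _ ip) (B _ _ _ _ ijk _ _ qk kj_s2' uqs)) (M 1).
- move: upq; rewrite -map_cat uniq_face_in => upq.
  exact: leq_trans (leq_add (B _ _ _ _ ikj _ _ ip qk upq) (A _ _ _ _ kji _ kj_s2')) (M 2).
- move: uqs; rewrite -map_cat uniq_face_in -addnA => uqs.
  exact: leq_trans (leq_add (A _ _ _ _ ikj _ ip) (B _ _ _ _ ijk _ _ qk kj_s2' uqs)) (M 3).
- apply: leq_trans (M 4); apply: leq_add (A _ _ _ _ kji _ kj_s2').
  exact: leq_add (A _ _ _ _ ikj _ ip) (A _ _ _ _ jki _ qk).
Qed.

Lemma via_insert i j k (s1 s2 : seq (inner (Insert f))) :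
    uniq [:: i; j; k] -> seg i k s1 -> seg k j s2 -> uniq (s1 ++ s2) ->
  (size s1 + size s2 <= (via_bound i j k).+1)%N.
Proof.
move=> ijk ik_s1 kj_s2 u12.
have [Ns1|Ns1] := boolP (None \in s1); first exact: via_insert_center.
have [Ns2|Ns2] := boolP (None \in s2).
  rewrite via_boundC addnC -(size_rev s1) -(size_rev s2).
  apply: via_insert_center (uniq3C ijk) _ (seg_rev kj_s2) (seg_rev ik_s1) _.
    by rewrite mem_rev.
  by rewrite -rev_cat rev_uniq.
have := nth_le_maxs (vias i j k ++ vias j i k).
rewrite -/(via_bound i j k); move: (via_bound i j k) => X M.
have jki := uniq3_rot ijk; have kij := uniq3_rot jki.
have [s1' -> s1'P] := seg_corner_corner (uniq3C kij) Ns1 ik_s1.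
have [s2' -> s2'P] := seg_corner_corner (uniq3C jki) Ns2 kj_s2.
rewrite !size_map ltnW // ltnS; apply: leq_trans (M 0).
exact: leq_add ((@ab _ _ _ _ (uniq3C kij)).1 _ s1'P) ((@ab _ _ _ _ (uniq3C jki)).1 _ s2'P).
Qed.

End Recursion.

(** The cyclic successor serves to name the two corners other than [k]. *)
Definition next3 (k : 'I_3) : 'I_3 := nth o0 [:: o1; o2; o0] k.

Lemma next3_sym (F : 'I_3 -> 'I_3 -> 'I_3 -> nat) i j k :
    (forall i j k, F i j k = F j i k) -> uniq [:: i; j; k] ->
  F (next3 k) (next3 (next3 k)) k = F i j k.
Proof.
move=> FC; elim/ord3_ind: i; elim/ord3_ind: j => //; elim/ord3_ind: k => // _ /=;
  exact: FC || exact: erefl.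
Qed.

Definition step_direct (a b : 'I_3 -> 'I_3 -> nat) (k : 'I_3) : nat :=
  direct_bound a b (next3 k) (next3 (next3 k)) k.

Definition step_via (a b : 'I_3 -> 'I_3 -> nat) (k : 'I_3) : nat :=
  via_bound a b (next3 k) (next3 (next3 k)) k.

Lemma bounded_insert f (a b : 'I_3 -> 'I_3 -> nat) :
    (forall i, bounded (f i) (a i) (b i)) ->
  bounded (Insert f) (fun k => (step_direct a b k).+1) (fun k => (step_via a b k).+1).
Proof.
move=> ab i j k ijk; split=> [s ij_s|s1 s2 ik_s1 kj_s2 u12].
  by rewrite /step_direct (next3_sym (direct_boundC a b) ijk); exact: direct_insert.
by rewrite /step_via (next3_sym (via_boundC a b) ijk); exact: via_insert.
Qed.

(** * Cycles *)

Definition direct_le t (n : nat) : Prop :=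
  forall i j, i != j -> forall s : seq (inner t), seg i j s -> (size s <= n)%N.

(** A path between corners of a new triangle either is a path between corners of
    the old one, or becomes one by a further step from the centre. *)
Lemma direct_le_face f n i : direct_le (Insert f) n -> direct_le (f i) n.
Proof.
have up x y l : path (@adj (net_graph (f i))) x (rcons (map inr l) y) ->
    path (@adj (net_graph (Insert f))) (face x)
      (rcons (map inr (map (@face_in f i) l)) (face y)).
  elim: l x => [|w l IHl] x /= /andP[xw]; first by rewrite !andbT face_adj.
  by move=> /IHl l_path; apply/andP; split=> //; have -> := @face_adj f i x (inr w).
move=> le_n.
have avoid_q p q (s : seq (inner (f i))) : p != q -> q != i -> seg p q s ->
    (size s <= n)%N.
  move=> pq qi /andP[s_path s_uniq]; have {}s_path := up _ _ _ s_path.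
  rewrite /= (negPf qi) in s_path.
  have u : uniq (map (@face_in f i) s) by rewrite (map_inj_uniq (@face_in_inj f i)).
  have [pi|pi] := eqVneq p i; last first.
    rewrite -(size_map (@face_in f i)); apply: (le_n _ _ pq).
    by rewrite /seg u andbT; rewrite (negPf pi) in s_path.
  rewrite ltnW // -(size_map (@face_in f i)).
  apply: (le_n _ _ pq (None :: map (@face_in f i) s)).
  rewrite /seg /= u andbT; apply/andP; split; last by apply/mapP => -[].
  by move: s_path; rewrite pi eqxx.
move=> p q pq s pq_s; have [qi|qi] := eqVneq q i; last exact: avoid_q pq_s.
rewrite -size_rev; apply: (avoid_q q p); last exact: seg_rev.
  by rewrite eq_sym.
by rewrite -qi.
Qed.

(** The corners and the centre: these four vertices separate the new triangles. *)
Definition special f (x : net_graph (Insert f)) : bool :=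
  if x is inr (Some _) then false else true.

Lemma free_map f (s : seq (net_graph (Insert f))) : ~~ has (@special f) s ->
  exists2 s', s = map inr s' & None \notin s'.
Proof.
elim: s => [|x s IH] /=; first by exists [::].
rewrite negb_or => /andP[xK /IH[s' -> Ns']].
by case: x xK => [//|[v|//]] _; exists (Some v :: s').
Qed.

Lemma segment_le f n (s : seq (net_graph (Insert f))) u v : direct_le (Insert f) n ->
    special u -> special v -> u != v -> ~~ has (@special f) s -> uniq s ->
    path (@adj (net_graph (Insert f))) u (rcons s v) ->
  (size s <= n)%N.
Proof.
move=> le_n uK vK uv /free_map[s' -> Ns'].
rewrite size_map; have [->//|s0] := eqVneq s' [::].
rewrite map_inj_uniq; last by move=> ? ? [].
move=> s_uniq /(path_in_face Ns' s0)[i [l [x [y [el eu ev xy]]]]].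
have corner w (z : net_graph (f i)) : special w -> w = face z -> exists c, z = inl c.
  by case: z => [c|z] wK ew; [exists c | rewrite ew in wK].
have [c ex] := corner _ _ uK eu; have [c' ey] := corner _ _ vK ev.
rewrite el size_map; apply: (@direct_le_face f n i le_n c c').
  by apply: contraNneq uv => cc'; rewrite eu ev ex ey cc'.
by rewrite /seg -ex -ey xy -(@uniq_face_in f i) -el.
Qed.

(** Between consecutive special vertices a path stays inside one new triangle. *)
Lemma walk_le f n m (s : seq (net_graph (Insert f))) u v : direct_le (Insert f) n ->
    special u -> special v -> uniq (u :: v :: s) -> (size s <= m)%N ->
    path (@adj (net_graph (Insert f))) u (rcons s v) ->
  (size s <= n + n.+1 * count (@special f) s)%N.
Proof.
move=> le_n; elim: m s u => [|m IH] s u uK vK uvs sm s_path.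
  by case: s sm {uvs s_path}.
have [sK|sK] := boolP (has (@special f) s); last first.
  apply: leq_trans (leq_addr _ _); apply: segment_le s_path => //.
  - by move: uvs => /= /and3P[]; rewrite inE negb_or => /andP[].
  - by case/and3P: uvs.
case/split_find: sK uvs sm s_path => y s1 s2 yK s1K.
rewrite cat_rcons 2!cons_uniq => /and3P[us vs].
rewrite cat_uniq => /and3P[s1_uniq _ /=].
case/andP=> ys2 s2_uniq sm; rewrite rcons_cat /= cat_path /= => /and3P[p1 p2 p3].
have uy : u != y by apply: contraNneq us => ->; rewrite inE mem_cat mem_head !orbT.
have yv : y != v by apply: contraNneq vs => <-; rewrite mem_cat mem_head orbT.
have vs2 : v \notin s2 by apply: contra vs => vs2; rewrite mem_cat inE vs2 !orbT.
have le1 : (size s1 <= n)%N.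
  by apply: (segment_le le_n uK yK uy s1K s1_uniq); rewrite rcons_path p1.
have le2 : (size s2 <= n + n.+1 * count (@special f) s2)%N.
  apply: IH p3 => //; first by rewrite /= inE negb_or yv ys2 vs2.
  by move: sm; rewrite size_cat /= addnS ltnS; exact: leq_trans (leq_addl _ _).
rewrite size_cat count_cat /= yK add1n addnS.
apply: leq_ltn_trans (leq_add le1 le2) _; rewrite ltn_add2l -addSn -mulnS.
by rewrite leq_mul2l leq_addl orbT.
Qed.

(** A cycle with at most one special vertex lies in one new triangle together
    with its corners, and induction applies.  Otherwise its special vertices,
    four at most, cut it into segments that each lie in one new triangle; the
    constant 6 is not optimal. *)
Lemma cycle_le t n (p : seq (net_graph t)) : direct_le t n -> ucycle (@adj _) p ->
  (2 < size p)%N -> (size p <= 6 * n.+1)%N.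
Proof.
elim: t p => [|f IH] p le_n p_cycle p_size.
  have /card_uniqP <- : uniq p by case/andP: p_cycle.
  apply: leq_trans (max_card _) _; rewrite card_sum card_ord card_void addn0.
  exact: leq_trans (leq_pmulr 6 (ltn0Sn n)).
have special4 s : uniq s -> (count (@special f) s <= 4)%N.
  move=> s_uniq; rewrite -size_filter.
  apply: (@uniq_leq_size _ _ [:: inl o0; inl o1; inl o2; center f]).
    exact: filter_uniq.
  move=> x; rewrite mem_filter => /andP[]; case: x => [c|[v|]] // _ _.
  by elim/ord3_ind: c.
have in_face x s : ucycle (@adj _) (x :: s) -> (2 < size (x :: s))%N ->
    ~~ has (@special f) s -> (size (x :: s) <= 6 * n.+1)%N.
  move=> xs_cycle xs_size /free_map[s0 es Ns0].
  move: xs_cycle xs_size; rewrite es => /andP[s_path s_uniq] s_size.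
  have s0_nil : s0 != [::] by apply: contraTneq s_size => ->.
  have [i [s1 [x1 [y1 [es1 ex ey xy]]]]] := path_in_face Ns0 s0_nil s_path.
  have y1x1 : y1 = x1 by apply: (@face_inj f i); rewrite -ey.
  have := IH i (x1 :: map inr s1) (direct_le_face le_n).
  move: s_size s_uniq; rewrite es1 /= !size_map => s_size s_uniq; apply => //.
  apply/andP; split; first by move: xy; rewrite y1x1.
  rewrite -(map_inj_uniq (@face_inj f i)) /= -map_comp.
  by move: s_uniq; rewrite ex -map_comp.
have [pK|pK] := boolP (has (@special f) p); last first.
  case: p pK p_cycle p_size => // x s /norP[_ sK] p_cycle p_size; exact: in_face.
have [k [y [s [ep yK]]]] : exists k y s, rot k p = y :: s /\ special y.
  case/hasP: pK => y yp yK; have [k s ek] := rot_to yp.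
  by exists k, y, s.
rewrite -(size_rot k) ep; rewrite -(size_rot k) ep in p_size.
have {p_cycle} : ucycle (@adj _) (y :: s).
  by rewrite -ep /ucycle rot_cycle rot_uniq.
have [sK|sK] := boolP (has (@special f) s); last first.
  by move=> s_cycle; exact: in_face.
case/split_find: sK {ep p_size} => z s1 s2 zK s1K /andP[/=].
rewrite cat_rcons mem_cat inE !negb_or cat_uniq.
rewrite rcons_cat /= cat_path /= => /and3P[p1 p2 p3].
case/and3P=> /and3P[ys1 yz ys2] s1_uniq /and3P[_ zs2 s2_uniq].
have le1 : (size s1 <= n)%N.
  by apply: (segment_le le_n yK zK yz s1K s1_uniq); rewrite rcons_path p1.
have le2 : (size s2 <= n + n.+1 * count (@special f) s2)%N.
  by apply: (walk_le le_n zK yK _ (leqnn _) p3); rewrite /= inE negb_or eq_sym yz zs2 ys2.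
have {}le2 : (size s2 <= n + n.+1 * 4)%N.
  by apply: leq_trans le2 _; rewrite leq_add2l leq_mul2l special4 ?orbT.
rewrite /= size_cat /= addnS; apply: (@leq_trans (n + (n + n.+1 * 4)).+2).
  by rewrite !ltnS leq_add.
by clear; lia.
Qed.

(** * Patterns *)

(** A network with two kinds of empty faces, those that stay empty and those that
    are to be filled. *)
Inductive pattern := Blank | Hole | Split of ('I_3 -> pattern).

Fixpoint fill (p : pattern) (t : network) : network :=
  match p with
  | Blank => Empty
  | Hole => t
  | Split f => Insert (fun i => fill (f i) t)
  end.

Definition pick3 T (x y z : T) (i : 'I_3) : T :=
  match val i with 0 => x | 1 => y | _ => z end.

Lemma pick3E T (g : 'I_3 -> T) : pick3 (g o0) (g o1) (g o2) = g.
Proof. by apply: funext; elim/ord3_ind. Qed.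

Lemma sum3E (F : 'I_3 -> nat) : (\sum_(i < 3) F i = F o0 + F o1 + F o2)%N.
Proof.
by rewrite !big_ord_recl big_ord0 addn0 addnA; congr (F _ + F _ + F _)%N; apply: val_inj.
Qed.

Lemma forall3E (P : pred 'I_3) : [forall c, P c] = [&& P o0, P o1 & P o2].
Proof. by apply/forallP/and3P => [h|[h0 h1 h2]]; [split | apply: ord3_ind]. Qed.

Fixpoint holes (p : pattern) : nat :=
  match p with
  | Blank => 0
  | Hole => 1
  | Split f => holes (f o0) + holes (f o1) + holes (f o2)
  end.

Fixpoint splits (p : pattern) : nat :=
  match p with
  | Split f => (splits (f o0) + splits (f o1) + splits (f o2)).+1
  | _ => 0
  end.

Lemma card_fill p t : #|inner (fill p t)| = (holes p * #|inner t| + splits p)%N.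
Proof.
elim: p => [||f IH] /=; first by rewrite card_void.
  by rewrite mul1n addn0.
rewrite (@card_inner (fun i => fill (f i) t) predT) /=.
under eq_bigr => i _ do rewrite (IH i : #|[pred v | _]| = _).
rewrite sum3E !mulnDl add1n addnS; congr S.
move: (holes (f o0) * _)%N (holes (f o1) * _)%N (holes (f o2) * _)%N; clear; lia.
Qed.

Definition subset3 (b0 b1 b2 : bool) : pred 'I_3 := pick3 b0 b1 b2.

(** The recursive bounds are stored as lists of values.  As functions they would
    evaluate the bounds of the subpatterns several times at each level, which is
    exponential in the depth of the pattern. *)
Definition table (e : pred 'I_3 -> nat) : seq nat :=
  [seq e (subset3 b.1.1 b.1.2 b.2) | b <- [:: (false, false, false);
    (true, false, false); (false, true, false); (true, true, false);
    (false, false, true); (true, false, true); (false, true, true);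
    (true, true, true)]].

Definition lookup (s : seq nat) (S : pred 'I_3) : nat :=
  nth 0 s (S o0 + (S o1).*2 + (S o2).*2.*2).

Lemma lookup_table e S : lookup (table e) S = e S.
Proof.
rewrite -[in RHS](pick3E S) /lookup /table.
by case: (S o0); case: (S o1); case: (S o2).
Qed.

Definition excess_step (e : 'I_3 -> pred 'I_3 -> nat) (S : pred 'I_3) : nat :=
  maxn (e o0 (put S o0 true) + e o1 (put S o1 true) + e o2 (put S o2 true)).-1
       ([&& S o0, S o1 & S o2] + (e o0 (put S o0 false)
          + e o1 (put S o1 false) + e o2 (put S o2 false))).

(** The bounds of [scatters_insert]; a hole counts like a triangle with a single
    inner vertex. *)
Fixpoint excess (p : pattern) : seq nat :=
  match p with
  | Blank => table (fun _ => 0)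
  | Hole => table (fun S => [&& S o0, S o1 & S o2] : nat)
  | Split f =>
      let e0 := excess (f o0) in let e1 := excess (f o1) in
      let e2 := excess (f o2) in
      table (excess_step (fun i => lookup (pick3 e0 e1 e2 i)))
  end%N.

(** The side condition of [unshattered_insert], throughout the pattern. *)
Fixpoint tight (p : pattern) : bool :=
  match p with
  | Split f =>
      [&& lookup (excess (f o0)) (pred1 o0) == 0,
          lookup (excess (f o1)) (pred1 o1) == 0,
          lookup (excess (f o2)) (pred1 o2) == 0,
          tight (f o0), tight (f o1) & tight (f o2)]
  | _ => true
  end%N.

(** To the outside, such a network behaves like a single vertex in the triangle. *)
Definition sound t : Prop :=
  (forall S, scatters t S [forall c, S c]) /\ unshattered t.

Lemma scatters_fill p t S : sound t -> scatters (fill p t) S (lookup (excess p) S).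
Proof.
case=> t_sc _; elim: p S => [||f IH] S; rewrite [excess _]/= lookup_table.
- exact: scatters_empty.
- by rewrite -forall3E.
have -> := pick3E (excess \o f).
rewrite /excess_step -forall3E.
have := @scatters_insert (fun i => fill (f i) t) (fun i => lookup (excess (f i)))
  S (fun i => IH i).
by rewrite !sum3E.
Qed.

Lemma unshattered_fill p t : sound t -> tight p -> unshattered (fill p t).
Proof.
move=> t_sound; elim: p => [||f IH].
- by move=> _; exact: unshattered_empty.
- by move=> _; case: t_sound.
case/and5P=> /eqP e0 /eqP e1 /eqP e2 t0 /andP[t1 t2].
apply: unshattered_insert => i; first by apply: IH; elim/ord3_ind: i.
have e_i : lookup (excess (f i)) (pred1 i) = 0%N by elim/ord3_ind: i.
by have := @scatters_fill (f i) t (pred1 i) t_sound; rewrite e_i.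
Qed.

Definition lookup_direct (s : seq nat) (k : 'I_3) : nat := nth 0%N s k.
Definition lookup_via (s : seq nat) (k : 'I_3) : nat := nth 0%N s (3 + k).

Definition tours_table (a b : 'I_3 -> nat) : seq nat :=
  [:: a o0; a o1; a o2; b o0; b o1; b o2].

(** The recursion of [bounded_insert], counting holes only: three bounds for the
    paths that avoid the third corner, then three for those by way of it. *)
Fixpoint tours (p : pattern) : seq nat :=
  match p with
  | Blank => tours_table (fun _ => 0%N) (fun _ => 0%N)
  | Hole => tours_table (fun _ => 1%N) (fun _ => 1%N)
  | Split f =>
      let t0 := tours (f o0) in let t1 := tours (f o1) in
      let t2 := tours (f o2) in
      let a i := lookup_direct (pick3 t0 t1 t2 i) in
      let b i := lookup_via (pick3 t0 t1 t2 i) in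
      tours_table (step_direct a b) (step_via a b)
  end.

Lemma lookup_directE a b : lookup_direct (tours_table a b) = a.
Proof. by apply: funext; elim/ord3_ind. Qed.

Lemma lookup_viaE a b : lookup_via (tours_table a b) = b.
Proof. by apply: funext; elim/ord3_ind. Qed.

Lemma bounded_leq t (a b a' b' : 'I_3 -> nat) :
    (forall k, (a k <= a' k)%N) -> (forall k, (b k <= b' k)%N) ->
  bounded t a b -> bounded t a' b'.
Proof.
move=> aa' bb' ab i j k ijk; split=> [s /(ab _ _ _ ijk).1 h|s1 s2 h1 h2 u].
  exact: leq_trans h (aa' k).
exact: leq_trans ((ab _ _ _ ijk).2 _ _ h1 h2 u) (bb' k).
Qed.

Lemma maxs_affine L N (l l' : seq nat) : size l = size l' ->
    (forall n, nth 0%N l n <= L * nth 0%N l' n + N)%N ->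
  (maxs l <= L * maxs l' + N)%N.
Proof.
elim: l l' => [|x l IH] [|y l'] //= [ell] h; rewrite geq_max.
have {}IH := IH _ ell (fun n => h n.+1); have := h 0%N => /= hx.
apply/andP; split; [apply: leq_trans hx _ | apply: leq_trans IH _];
  by rewrite leq_add2r leq_mul2l leq_max leqnn ?orbT.
Qed.

(** Each alternative of the maxima uses every new triangle at most once, so the
    additive constants do not accumulate beyond their sum. *)
Lemma bound_affine L (n : 'I_3 -> nat) (a b : 'I_3 -> 'I_3 -> nat) i j k :
  let a' i k := (L * a i k + n i)%N in let b' i k := (L * b i k + n i)%N in
  let N := (n i + n j + n k)%N in
  (direct_bound a' b' i j k <= L * direct_bound a b i j k + N)%N /\
  (via_bound a' b' i j k <= L * via_bound a b i j k + N)%N.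
Proof.
move=> a' b' N; split; apply: maxs_affine => // m; rewrite /a' /b' /N.
  by do 8![case: m => [|m] /=; first by rewrite ?mulnDr; lia]; case: m.
by do 10![case: m => [|m] /=; first by rewrite ?mulnDr; lia]; case: m.
Qed.

Lemma sum_next (n : 'I_3 -> nat) k :
  (n o0 + n o1 + n o2 = n (next3 k) + n (next3 (next3 k)) + n k)%N.
Proof. by elim/ord3_ind: k; rewrite /next3 /=; lia. Qed.

(** A path visits at most [L] vertices in every hole that it visits, besides the
    vertices of the pattern itself. *)
Lemma bounded_fill p t L : bounded t (fun=> L) (fun=> L) ->
  bounded (fill p t) (fun k => L * lookup_direct (tours p) k + splits p)%N
                     (fun k => L * lookup_via (tours p) k + splits p)%N.
Proof.
move=> t_le; elim: p => [||f IH].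
- by move=> i j k _; split=> [[|[]]//|[|[]]// [|[]]].
- by apply: bounded_leq t_le => k /=; rewrite ?lookup_directE ?lookup_viaE; lia.
rewrite [tours _]/= (pick3E (tours \o f)) lookup_directE lookup_viaE.
apply: bounded_leq (bounded_insert IH) => k /=; rewrite addnS ltnS.
- have /= -> := sum_next (splits \o f) k.
  exact: (bound_affine L (splits \o f) _ (fun i => lookup_via (tours (f i))) _ _ k).1.
- have /= -> := sum_next (splits \o f) k.
  exact: (bound_affine L (splits \o f) (fun i => lookup_direct (tours (f i))) _ _ _ k).2.
Qed.

(** * The towers of the gadget *)

Definition split3 (p q r : pattern) : pattern := Split (pick3 p q r).

(** A path that avoids one corner visits two of the three holes only. *)
Definition star : pattern := split3 Hole Hole Hole.

(** A path between two corners visits all seven holes only if it goes by way of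
    corner 2, and at most five if it avoids a corner.  The price is an excess of
    2 if all corners are removed. *)
Definition cluster : pattern :=
  split3 (split3 Blank star Blank) (split3 Blank star Blank) Hole.

(** The two clusters and two further holes are placed in such a way that no path
    can exhaust both clusters, while enough vertices lie around them to bring the
    excess down to that of a single vertex. *)
Definition gadget : pattern :=
  split3 Blank
    (split3 Blank Blank
      (split3 Hole Hole
        (split3 Blank
          (split3
            (split3 (split3 Blank (split3 cluster Blank Blank) Blank) cluster Blank)
            Blank Blank)
          Blank)))
    Blank.

Lemma gadget_excess : excess gadget = table (fun S => [&& S o0, S o1 & S o2] : nat).
Proof. by vm_compute. Qed.

Lemma gadget_tight : tight gadget.
Proof. by vm_compute. Qed.

Lemma gadget_tours : all (fun n => (n <= 12)%N) (tours gadget).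
Proof. by vm_compute. Qed.

Lemma gadget_holes : holes gadget = 16%N.
Proof. by vm_compute. Qed.

Lemma gadget_splits : splits gadget = 18%N.
Proof. by vm_compute. Qed.

Fixpoint tower (n : nat) : network :=
  if n is n'.+1 then fill gadget (tower n') else Empty.

(** The recursion of [bounded_fill] for the gadget, which has 18 inner vertices
    and at most 12 holes on a path. *)
Fixpoint reach (n : nat) : nat :=
  if n is n'.+1 then (12 * reach n' + 18)%N else 0%N.

Lemma tower_sound n : sound (tower n).
Proof.
elim: n => [|n IH] /=.
  by split=> [S|]; [exact: scatters_empty | exact: unshattered_empty].
split=> [S|]; last exact: unshattered_fill IH gadget_tight.
have := @scatters_fill gadget _ S IH.
by rewrite gadget_excess lookup_table -forall3E.
Qed.

Lemma tower_bounded n : bounded (tower n) (fun=> reach n) (fun=> reach n).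
Proof.
elim: n => [|n IH].
  by move=> i j k _; split=> [[|[]]//|[|[]]// [|[]]].
have le12 m : (nth 0 (tours gadget) m <= 12)%N.
  have [lt_m|le_m] := ltnP m (size (tours gadget)); last by rewrite nth_default.
  exact: (allP gadget_tours) (mem_nth _ lt_m).
apply: bounded_leq (bounded_fill gadget IH) => k;
  rewrite gadget_splits [reach _.+1]/= leq_add2r mulnC leq_mul2r;
  apply/orP; right; exact: le12.
Qed.

Lemma tower_circumference n : (circumference (net_graph (tower n)) <= 108 * 12 ^ n)%N.
Proof.
have reach_le : (reach n + 18 <= 18 * 12 ^ n)%N.
  elim: n => [//|n IH]; rewrite [reach _]/= expnS; lia.
have direct : direct_le (tower n) (reach n).
  move=> i j ij s ij_s.
  have [k ijk] : exists k, uniq [:: i; j; k].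
    by move: ij; elim/ord3_ind: i {ij_s}; elim/ord3_ind: j => // _;
       (by exists o0) || (by exists o1) || (by exists o2).
  exact: (tower_bounded n ijk).1.
apply/bigmax_leqP => k /andP[k_gt2 /existsP[p p_cycle]].
have p_size : (2 < size p)%N by rewrite size_tuple.
rewrite -(size_tuple p); apply: leq_trans (cycle_le direct p_cycle p_size) _.
by move: reach_le; clear; lia.
Qed.

Lemma card_net t : #|net_graph t| = (#|inner t| + 3)%N.
Proof. by rewrite card_sum card_ord addnC. Qed.

Lemma card_tower n : #|inner (tower n.+1)| = (16 * #|inner (tower n)| + 18)%N.
Proof. by rewrite card_fill gadget_holes gadget_splits. Qed.

Lemma tower_card n : (16 ^ n < #|net_graph (tower n)|)%N.
Proof.
rewrite card_net; suff : (16 ^ n <= #|inner (tower n)| + 1)%N by lia.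
by elim: n => [|n IH]; [rewrite addn1 | rewrite card_tower expnS; lia].
Qed.

Lemma tower_iso m n : isomorphic (net_graph (tower m)) (net_graph (tower n)) -> m = n.
Proof.
have mono : {homo (fun n => #|inner (tower n)|) : i j / (i < j)%N}.
  apply: homo_ltn => [|i]; first exact: ltn_trans.
  by change (#|inner (tower i)| < #|inner (tower i.+1)|)%N; rewrite card_tower; lia.
case=> h [h_bij _]; have := bij_eq_card h_bij; rewrite !card_net => /addIn e.
by case: (ltngtP m n) => // /mono /=; rewrite e ltnn.
Qed.

(** Bernoulli's inequality for 11 / 10, which is a lower bound for the quotient
    of 16 ^ 9 and 12 ^ 10. *)
Lemma powers_dominate (K : nat) :
  exists n0, forall n, (n0 <= n)%N -> (K * 10 ^ n <= 11 ^ n)%N.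
Proof.
have bern n : (10 ^ n * (10 + n) <= 10 * 11 ^ n)%N.
  by elim: n => [//|n IH]; rewrite !expnS; nia.
exists (10 * K)%N => n Kn; rewrite -(leq_pmul2l (isT : 0 < 10)%N).
apply: leq_trans (bern n); rewrite mulnA mulnC leq_mul2l.
by rewrite (leq_trans Kn) ?orbT // leq_addl.
Qed.

Section Exponent.
Variable R : realType.

(** Both sides are compared with 9 / 10; the right one by 30 ^ 9 <= 22 ^ 10. *)
Lemma logb_le (c N : nat) : (1 < N)%N -> c%:R ^+ 10 <= N%:R ^+ 9 :> R ->
  logb N%:R c%:R <= logb (30 : R) 22.
Proof.
move=> N1 cN; have lnN : 0 < ln (N%:R : R) by rewrite ln_gt0 ?ltr1n.
have ln30 : 0 < ln (30 : R) by rewrite ln_gt0 ?ltr1n.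
have ln22 : 0 < ln (22 : R) by rewrite ln_gt0 ?ltr1n.
have h30 : ln (30 : R) *+ 9 <= ln (22 : R) *+ 10.
  rewrite -!lnXn ?ltr0n // ler_ln ?posrE ?exprn_gt0 ?ltr0n //; lra.
have hc : ln (c%:R : R) *+ 10 <= ln (N%:R : R) *+ 9.
  case: c cN => [|c] cN; first by rewrite ln0 ?lexx // mul0rn mulrn_wge0 // ltW.
  by rewrite -!lnXn ?ltr0n ?(ltnW N1) // ler_ln ?posrE ?exprn_gt0 ?ltr0n ?(ltnW N1).
rewrite /logb ler_pdivrMr // mulrAC ler_pdivlMr //.
have h1 : ln c%:R *+ 10 * ln 30 <= ln N%:R *+ 9 * ln (30 : R) by rewrite ler_pM2r.
have h2 : ln 30 *+ 9 * ln N%:R <= ln 22 *+ 10 * ln (N%:R : R) by rewrite ler_pM2r.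
lra.
Qed.

Lemma tower_exponent : exists n0, forall n, (n0 <= n)%N ->
  logb #|net_graph (tower n)|%:R (circumference (net_graph (tower n)))%:R
    <= logb (30 : R) 22.
Proof.
have [n0 dom] := powers_dominate (108 ^ 10).
exists n0 => n /dom n_large; apply: logb_le.
  by apply: leq_ltn_trans (tower_card n); rewrite expn_gt0.
have c_le : (circumference (net_graph (tower n)))%:R <= 108 * 12 ^+ n :> R.
  by rewrite -natrX -natrM ler_nat tower_circumference.
have N_ge : 16 ^+ n <= #|net_graph (tower n)|%:R :> R.
  by rewrite -natrX ler_nat ltnW ?tower_card.
have {}n_large : 108 ^+ 10 * 10 ^+ n <= 11 ^+ n :> R.
  by rewrite -!natrX -natrM ler_nat.
apply: (@le_trans _ _ ((108 * 12 ^+ n) ^+ 10)).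
  by rewrite lerXn2r ?nnegrE ?ler0n // mulr_ge0 ?exprn_ge0.
apply: (@le_trans _ _ ((16 ^+ n) ^+ 9)); last first.
  by rewrite lerXn2r ?nnegrE ?ler0n ?exprn_ge0.
rewrite exprMn -!exprM mulnC (mulnC n 9) !exprM.
have r : ((12 : R) ^+ 10) ^+ n * 11 ^+ n <= (16 ^+ 9) ^+ n * 10 ^+ n.
  by rewrite -!exprMn lerXn2r ?nnegrE; lra.
rewrite -(ler_pM2r (_ : 0 < 10 ^+ n)) ?exprn_gt0 //.
apply: le_trans r; rewrite mulrAC mulrC ler_wpM2l ?exprn_ge0 //.
Qed.

End Exponent.

Lemma limn_einf_le (R : realType) (u : nat -> \bar R) (l : \bar R) :
  (forall n, (u n <= l)%E) -> (limn_einf u <= l)%E.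
Proof.
move=> ul; rewrite limn_einf_lim; apply: lime_le; first exact: is_cvg_einfs.
apply: nearW => n; apply: le_trans (ul n); apply: ereal_inf_lbound.
by exists n => /=.
Qed.

Theorem theorem7 (R : realType) :
  (shortness_exponent R
     (fun G : sgraph => [/\ tough (1 : R) G, planar R G & ktree 3 G])
   <= (logb (30 : R) 22)%:E)%E.
Proof.
have [n0 short] := tower_exponent R.
pose G n := net_graph (tower (n0 + n)).
apply: (@le_trans _ _ (limn_einf (fun n =>
    (logb #|G n|%:R (circumference (G n))%:R : R)%:E))); last first.
  by apply: limn_einf_le => n; rewrite lee_fin; apply: short; rewrite leq_addr.
apply: ereal_inf_lbound; exists G; split=> // [n|m n mn /tower_iso/addnI//].
split; [|exact: net_planar | exact: net_ktree].
by have [sc un] := tower_sound (n0 + n); exact: net_tough.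
Qed.
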